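(* Let $n\ge1$ and let $N$ be a subsemigroup of $B(n)$ containing $0$. The following are equivalent: (i) $N$ is a nilpotent semigroup; (ii) the binary relation $N\setminus\{0\}$ on $\{1,\dots,n\}$ is irreflexive and transitive, i.e. a strict partial order; (iii) the directed graph $\Gamma(N)$ is acyclic.
   Context: For $n\ge1$, $B(n)$ denotes the aperiodic Brandt semigroup: the set $(\{1,\dots,n\}\times\{1,\dots,n\})\cup\{0\}$, where $0$ is a zero element and $(i,j)(k,l)=(i,l)$ if $j=k$ and $(i,j)(k,l)=0$ otherwise. A nonzero element $(i,j)$ is viewed as the pair $(i,j)$ of a binary relation on $\{1,\dots,n\}$. A semigroup $N$ with zero $0$ is nilpotent if $N^k=\{0\}$ for some positive integer $k$ (the product of any $k$ elements is $0$). For $N\subseteq B(n)$, $\Gamma(N)$ is the directed graph with vertex set $\{1,\dots,n\}$ and an edge $i\to j$ for each $(i,j)\in N$ (loops allowed); acyclic means it has no directed cycle (including loops). *)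

(* Defs.v *)
From HB Require Import structures.
From mathcomp Require Import all_boot.

Set Implicit Arguments.
Unset Strict Implicit.
Unset Printing Implicit Defensive.

Local Open Scope group_scope.

(* None is the zero element, Some (i, j) the nonzero element (i, j); the index
   set {1, ..., n} is represented by 'I_n = {0, ..., n - 1}. *)
Definition brandt (n : nat) : Type := option ('I_n * 'I_n).

HB.instance Definition _ (n : nat) :=
  Finite.copy (brandt n) (option ('I_n * 'I_n)).

Definition brandt_zero (n : nat) : brandt n := None.

Definition brandt_mul (n : nat) (x y : brandt n) : brandt n :=
  match x, y with
  | Some (i, j), Some (k, l) => if j == k then Some (i, l) else None
  | _, _ => None
  end.

Lemma brandt_mulA (n : nat) : associative (@brandt_mul n).
Proof.
case=> [[i j]|] [[k l]|] [[p q]|] //=; last by case: (j == k).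
by case E1 : (l == p); case E2 : (j == k); rewrite /= ?E1 ?E2.
Qed.

HB.instance Definition _ (n : nat) :=
  isSemigroup.Build (brandt n) (@brandt_mulA n).

Definition subsemigroup (n : nat) (N : {set brandt n}) : Prop := mulg_closed N.

(* set_pow N k is the set N^k of all products of k elements of N, for k > 0
   (the value at k = 0 is irrelevant). *)
Definition set_pow (n : nat) (N : {set brandt n}) (k : nat) : {set brandt n} :=
  iter k.-1
    (fun M : {set brandt n} => [set x * y | x : brandt n in N, y : brandt n in M]) N.

Definition nilpotent_semigroup (n : nat) (N : {set brandt n}) : Prop :=
  exists k : nat, (0 < k)%N /\ set_pow N k = [set brandt_zero n].

(* N \ {0} as a binary relation; it is also the edge relation of the directed
   graph Gamma(N). *)
Definition brandt_rel (n : nat) (N : {set brandt n}) : rel 'I_n :=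
  fun i j => (Some (i, j) : brandt n) \in N.

Definition strict_order (T : Type) (r : rel T) : Prop :=
  irreflexive r /\ transitive r.

(* A directed cycle is a nonempty sequence of distinct vertices in which each
   vertex has an edge to the next one, cyclically; [:: i] is a loop at i. *)
Definition acyclic (T : eqType) (e : rel T) : Prop :=
  ~ exists2 c : seq T, c != [::] & ucycle e c.

(* Main.v *)
Require Import Defs.
From mathcomp Require Import all_boot.

(** A subsemigroup of B(n) is automatically a transitive relation, so each of the
three conditions amounts to irreflexivity. A nonzero element of N^k is a walk of
length k in Gamma(N); for a strict order walks have distinct vertices, so N^n has
no nonzero element, whereas a loop (i, i) is an idempotent lying in every N^k. *)

Lemma sorted_strict_order_uniq (T : eqType) (r : rel T) (s : seq T) :
  strict_order r -> sorted r s -> uniq s.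
Proof. by case=> irr tr; apply: sorted_uniq. Qed.

Lemma strict_order_acyclic (T : eqType) (r : rel T) :
  strict_order r -> acyclic r.
Proof.
move=> so [[//|x p] _ /andP[/= cyc _]].
(* The closed walk from [x] through [p] back to [x] is sorted for [r], yet lists [x] twice. *)
have := @sorted_strict_order_uniq _ _ (x :: rcons p x) so cyc.
by rewrite /= mem_rcons inE eqxx.
Qed.

Lemma acyclic_irreflexive (T : eqType) (r : rel T) : acyclic r -> irreflexive r.
Proof.
move=> acyc i; apply/negP => rii; apply: acyc.
by exists [:: i]; rewrite // /ucycle /= rii.
Qed.

Lemma brandt_mulE (n : nat) (i j k l : 'I_n) :
  ((Some (i, j) : brandt n) * Some (k, l))%g =
    if j == k then Some (i, l) else None.
Proof. by []. Qed.

Lemma brandt_rel_trans (n : nat) (N : {set brandt n}) :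
  subsemigroup N -> transitive (brandt_rel N).
Proof.
move=> subN j i k Nij Njk; have := subN _ _ Nij Njk.
by rewrite brandt_mulE eqxx.
Qed.

Lemma set_powSS (n : nat) (N : {set brandt n}) (k : nat) :
  set_pow N k.+2 =
    [set (x * y)%g | x : brandt n in N, y : brandt n in set_pow N k.+1].
Proof. by []. Qed.

(** Replacing [e] by [e * e] raises the exponent by one. This serves both the loops [(i, i)] and the
    zero element. *)
Lemma idempotent_set_pow (n : nat) (N : {set brandt n}) (e : brandt n) (k : nat) :
  (e * e = e)%g -> e \in N -> e \in set_pow N k.
Proof.
(* Exponents 0 and 1 both denote [N] itself, so the induction starts at 1. *)
move=> ee eN; case: k => [//|k]; elim: k => [//|k IHk].
by rewrite set_powSS -ee; apply: imset2_f.
Qed.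

(** Peel off the left factor: a product of two pairs is nonzero only if the inner indices agree, so
    this factor prepends an edge to the walk given by the other. *)
Lemma set_pow_walk (n : nat) (N : {set brandt n}) (k : nat) (i j : 'I_n) :
  (Some (i, j) : brandt n) \in set_pow N k.+1 ->
  exists p, [/\ path (brandt_rel N) i p, last i p = j & size p = k.+1].
Proof.
elim: k i j => [|k IHk] i j; first by exists [:: j]; rewrite /= andbT.
rewrite set_powSS => /imset2P[[[a b]|] [[c d]|] //= Nab Ncd].
rewrite brandt_mulE; case: eqP => // bc [-> ->]; subst c.
have [p [pp lp sp]] := IHk _ _ Ncd.
by exists (b :: p); split=> //=; [apply/andP|rewrite sp].
Qed.

Lemma nilpotent_irreflexive (n : nat) (N : {set brandt n}) :
  nilpotent_semigroup N -> irreflexive (brandt_rel N).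
Proof.
move=> [k [_ Nk0]] i; apply/negP => Nii.
have ii : ((Some (i, i) : brandt n) * Some (i, i) = Some (i, i))%g.
  by rewrite brandt_mulE eqxx.
by have := @idempotent_set_pow _ _ _ k ii Nii; rewrite Nk0 inE.
Qed.

Lemma strict_order_nilpotent (n : nat) (N : {set brandt n}) :
  (0 < n)%N -> brandt_zero n \in N -> strict_order (brandt_rel N) ->
  nilpotent_semigroup N.
Proof.
(* Exponent [n] suffices: a walk with [n] edges lists [n + 1] vertices, which cannot be distinct in
   ['I_n]. *)
move=> n_gt0 N0 so; exists n; split=> //.
apply/setP=> x; rewrite inE; apply/idP/eqP => [|->]; last first.
  (* Zero is an idempotent of [N], so it lies in the power. *)
  exact: idempotent_set_pow.
case: x => [[i j]|//]; rewrite -{2}(prednK n_gt0) => /set_pow_walk[p [pp _ sp]].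
have /card_uniqP card_p := @sorted_strict_order_uniq _ _ (i :: p) so pp.
by have := max_card (mem (i :: p)); rewrite card_p card_ord /= sp prednK // ltnn.
Qed.

Theorem theorem5p4 (n : nat) (N : {set brandt n}) (n_ge1 : (1 <= n)%N)
    (N_sub : subsemigroup N) (N_zero : brandt_zero n \in N) :
  (nilpotent_semigroup N <-> strict_order (brandt_rel N)) /\
  (strict_order (brandt_rel N) <-> acyclic (brandt_rel N)).
Proof.
have tr := @brandt_rel_trans _ _ N_sub.
split; split.
- by move=> nilN; split=> //; apply: nilpotent_irreflexive.
- exact: strict_order_nilpotent.
- exact: strict_order_acyclic.
- by move=> acyc; split=> //; apply: acyclic_irreflexive.
Qed.
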